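(* Let $f$ be convex, let $\mathcal{C}$ be closed and convex, let $h$ be the reference function with Bregman divergence $D$, assume $x_0\in\mathcal{C}\cap\operatorname{int}(\mathcal{X})$ and $x_\star\in\operatorname{ri}(\mathcal{C})\cap\operatorname{int}(\mathcal{X})$, and let $(x_t)_{t\ge 0}$ be the iterates of mirror Polyak, all as specified in the context. If $f$ is $G$-Lipschitz continuous and $\mu$-strongly convex relative to $h$ on the set $\mathcal{C}$, with $G,\mu>0$, then for every integer $T>1$, $$\min_{0\le t\le T} f(x_t)-f_\star\le\frac{4G^2}{\mu}\,\frac{\log(T)}{T}.$$
   Context: Setting: $\mathcal{X}\subseteq\mathbb{R}^d$ is convex with nonempty interior, $f:\mathcal{X}\to\mathbb{R}$ is a proper convex function, and $\mathcal{C}\subseteq\mathbb{R}^d$ is a closed convex set such that $f$ attains a finite minimum $f_\star := f(x_\star)$ over $\mathcal{X}\cap\mathcal{C}$ at a point $x_\star\in\mathcal{X}\cap\mathcal{C}$. $g(x)\in\partial f(x)$ denotes a fixed selection of a subgradient of $f$ at $x$. The reference function $h:\mathcal{X}\to\mathbb{R}$ is a convex function of Legendre type with domain $\mathcal{X}$ (closed proper convex, essentially smooth, strictly convex on $\operatorname{int}(\mathcal{X})$; essentially smooth means that $h$ is differentiable on the nonempty set $\operatorname{int}(\mathcal{X})$ and $\|\nabla h(x_k)\|\to\infty$ whenever $(x_k)$ is a sequence in $\operatorname{int}(\mathcal{X})$ converging to a boundary point of $\mathcal{X}$). Its Bregman divergence is $D(x,y):=h(x)-h(y)-\langle\nabla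 h(y),x-y\rangle$ for $x\in\mathcal{X}$, $y\in\operatorname{int}(\mathcal{X})$. $\operatorname{ri}$ denotes relative interior, $\operatorname{int}$ interior; $\log$ is the natural logarithm. Mirror Polyak: starting from $x_0\in\mathcal{C}\cap\operatorname{int}(\mathcal{X})$, for every $t\ge0$, $$x_{t+1}\in\arg\min_{x\in\mathcal{X}\cap\mathcal{C}} D(x,x_t)\quad\text{such that}\quad f(x_t)+\langle g(x_t),x-x_t\rangle=f_\star .$$ Relative geometry on $\mathcal{C}$: $f$ is $G$-Lipschitz continuous relative to $h$ on $\mathcal{C}$ if $\langle g(x),x-y\rangle\le G\sqrt{2D(y,x)}$ for all $x\in\mathcal{C}\cap\operatorname{int}(\mathcal{X})$, $y\in\mathcal{C}\cap\mathcal{X}$; $f$ is $\mu$-strongly convex relative to $h$ on $\mathcal{C}$ if $f(y)\ge f(x)+\langle g(x),y-x\rangle+\mu\,D(y,x)$ for all $x\in\mathcal{C}\cap\operatorname{int}(\mathcal{X})$, $y\in\mathcal{C}\cap\mathcal{X}$. *)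

(* Defs.v *)
From HB Require Import structures.
From mathcomp Require Import all_boot all_order all_algebra.
From mathcomp Require Import all_classical all_reals all_analysis.

Set Implicit Arguments.
Unset Strict Implicit.
Unset Printing Implicit Defensive.

Import Order.TTheory GRing.Theory Num.Theory.
Import numFieldNormedType.Exports.

Local Open Scope classical_set_scope.
Local Open Scope ring_scope.

Section Convexity.
Context {R : realType} {d : nat}.
Implicit Types (A C X : set 'rV[R]_d) (f h : 'rV[R]_d -> R) (x y v : 'rV[R]_d).

Definition dotp x y : R := \sum_(i < d) x ord0 i * y ord0 i.

Definition affine_set A :=
  forall x y (t : R), A x -> A y -> A (t *: x + (1 - t) *: y).

Definition affine_hull C : set 'rV[R]_d := smallest affine_set C.

Definition rel_interior C : set 'rV[R]_d :=
  [set x | affine_hull C x /\ \forall y \near x, affine_hull C y -> C y].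

Definition strictly_convex_on A h :=
  forall x y (t : R), A x -> A y -> x != y -> 0 < t < 1 ->
    h (t *: x + (1 - t) *: y) < t * h x + (1 - t) * h y.

(* A function X -> R is represented by a total function of which only the
   values on X matter; as an extended-valued function it is +oo off X. Since
   v is tested against all of X, this is the subdifferential of that extension
   at the points of X. *)
Definition subdifferential X f x : set 'rV[R]_d :=
  [set v | forall y, X y -> f x + dotp v (y - x) <= f y].

(* The lower semicontinuity of the extension by +oo says that h is a closed
   function with domain X; X itself need not be a closed set. *)
Definition closed_on X h :=
  lower_semicontinuous (patch (fun=> +oo%E) X (fun x => (h x)%:E)).

Definition grad h x : 'rV[R]_d := \row_(i < d) 'D_(delta_mx ord0 i) h x.

(* `|_| is the library's (maximum) norm on row vectors; divergence to infinity
   does not depend on the choice of a norm on R^d. *)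
Definition essentially_smooth X h :=
  [/\ X° !=set0,
      forall x, X° x -> differentiable h x &
      forall (u : nat -> 'rV[R]_d) (b : 'rV[R]_d),
        (forall k, X° (u k)) -> u @ \oo --> b -> (closure X `\` X°) b ->
        `|grad h (u k)| @[k --> \oo] --> +oo].

(* Properness: h is real-valued on X, and X is nonempty by essential
   smoothness. *)
Definition legendre X h :=
  [/\ convex_set X, convex_function X h, closed_on X h,
      essentially_smooth X h & strictly_convex_on X° h].

(* Meaningful for y in the interior of the domain of h. *)
Definition bregman h x y : R := h x - h y - dotp (grad h y) (x - y).

End Convexity.

Section MirrorPolyak.
Context {R : realType} {d : nat}.
Implicit Types (X C S : set 'rV[R]_d) (f h phi : 'rV[R]_d -> R).
Implicit Types (g : 'rV[R]_d -> 'rV[R]_d) (fs G mu : R) (x y : 'rV[R]_d).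

Definition argmin S phi : set 'rV[R]_d :=
  [set z | S z /\ forall y, S y -> phi z <= phi y].

Definition polyak_feasible X C f g fs y : set 'rV[R]_d :=
  [set z | [/\ X z, C z & f y + dotp (g y) (z - y) = fs]].

(* Only x 0 is required to lie in the interior of X; when h is of Legendre
   type, the minimization keeps the later iterates there. *)
Definition mirror_polyak X C f g h fs (x : nat -> 'rV[R]_d) :=
  (C `&` X°) (x 0%N) /\
  forall t, argmin (polyak_feasible X C f g fs (x t))
                   (fun z => bregman h z (x t)) (x t.+1).

Definition relatively_lipschitz X C g h G :=
  forall x y, (C `&` X°) x -> (C `&` X) y ->
    dotp (g x) (x - y) <= G * Num.sqrt (2 * bregman h y x).

Definition relatively_strongly_convex X C f g h mu :=
  forall x y, (C `&` X°) x -> (C `&` X) y ->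
    f x + dotp (g x) (y - x) + mu * bregman h y x <= f y.

End MirrorPolyak.

(* Main.v *)
Require Import Defs.
From mathcomp Require Import all_boot all_order all_algebra.
From mathcomp Require Import all_classical all_reals all_analysis.
From mathcomp Require Import ring lra.
Set Implicit Arguments.
Unset Strict Implicit.
Unset Printing Implicit Defensive.

Import Order.TTheory GRing.Theory Num.Theory.
Import numFieldNormedType.Exports.
Local Open Scope classical_set_scope.
Local Open Scope ring_scope.

(** The proof follows the distance D_t = D(x_star, x_t) and shows that a large
    optimality gap delta_t = f(x_t) - f* forces it to contract.

    The iterate x_{t+1} is the Bregman projection of y = x_t on the hyperplane
    H where the linearization l of f at y equals f*. Strong convexity places
    x_star beyond H, with l(x_star) <= f* - mu D_t, while l(y) = f* + delta_t.
    The segment from y to x_star therefore meets H, and testing the optimality of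
    x_{t+1} against the meeting point sharpens the Pythagorean inequality into
      delta_t D_{t+1} + (l(y) - l(x_star)) D(x_{t+1}, x_t) <= delta_t D_t
    ([bregman_hyperplane_projection]). Since l(y) - l(x_{t+1}) = delta_t, the
    relative Lipschitz condition gives D(x_{t+1}, x_t) >= delta_t^2 / (2 G^2),
    and with l(y) - l(x_star) >= mu D_t the inequality becomes
      D_{t+1} <= (1 - a_t) D_t,  where a_t = mu delta_t / (2 G^2)
    ([mirror_polyak_step]).

    Conversely, a large gap keeps D_t away from zero: the two relative
    conditions at the pair (x_t, x_star) give delta_t + mu D_t <= G sqrt(2 D_t)
    ([polyak_gap_le]), that is a_t + E_t <= sqrt E_t for
    E_t = mu^2 D_t / (2 G^2); in particular E_0 <= 1. If every a_t with t <= T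
    were at least m > 2 log T / T, then m^2 <= E_T <= (1 - m)^T <= exp(- m T),
    which is below 1 / T^2, so m <= 1 / T <= 2 log T / T, a contradiction
    ([contraction_log_rate]). Undoing the scaling turns the bound
    a <= 2 log T / T into delta <= (4 G^2 / mu) log T / T.

    All of this needs gradients of h at the iterates, so the iterates must not
    reach the boundary of X; this is where essential smoothness enters
    ([argmin_bregman_interior]). *)

(** * Segments, directional derivatives and Bregman divergences *)

Section Segments.
Context {R : realType} {d : nat}.
Implicit Types (X : set 'rV[R]_d) (h : 'rV[R]_d -> R) (u v w x y z : 'rV[R]_d).

Lemma dotpDr u v w : dotp u (v + w) = dotp u v + dotp u w.
Proof. by rewrite -big_split; apply: eq_bigr => i _; rewrite mxE mulrDr. Qed.

Lemma dotpBr u v w : dotp u (v - w) = dotp u v - dotp u w.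
Proof. by rewrite -sumrB; apply: eq_bigr => i _; rewrite !mxE mulrBr. Qed.

Lemma dotpZr u (s : R) v : dotp u (s *: v) = s * dotp u v.
Proof. by rewrite mulr_sumr; apply: eq_bigr => i _; rewrite mxE mulrCA. Qed.

Lemma dotp_delta u i : dotp u (delta_mx ord0 i) = u ord0 i.
Proof.
rewrite /dotp (bigD1 i)//= mxE !eqxx mulr1 big1 ?addr0// => j ji.
by rewrite mxE (negPf ji) andbF mulr0.
Qed.

(** Segments are parametrized from y towards x, which makes derivatives at y
    appear directly; this is the link with the library's convex combinations. *)
Lemma segment_convE x y (s : {i01 R}) :
  y + s%:num *: (x - y) = conv s (x : convex_lmodType 'rV[R]_d) y.
Proof.
by rewrite /conv/= /unstable.onem scalerBl scale1r scalerBr addrCA addrA.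
Qed.

Lemma convex_set_segment X x y (s : R) :
  convex_set X -> X x -> X y -> 0 <= s <= 1 -> X (y + s *: (x - y)).
Proof.
move=> cX Xx Xy /andP[s0 s1]; have /= := segment_convE x y (Itv01 s0 s1).
by move=> ->; apply/set_mem/cX; exact/mem_set.
Qed.

Lemma convex_function_segment X h x y (s : R) :
  convex_function X h -> X x -> X y -> 0 <= s <= 1 ->
  h (y + s *: (x - y)) <= h y + s * (h x - h y).
Proof.
move=> ch Xx Xy /andP[s0 s1]; have /= := segment_convE x y (Itv01 s0 s1).
move=> ->; apply: le_trans (ch _ _ _ (mem_set Xx) (mem_set Xy)) _.
by rewrite convRE/= /unstable.onem; lra.
Qed.

(** The homothety of centre y and ratio s maps the neighbourhood X of x into X,
    and its image is a neighbourhood of the point at parameter s. *)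
Lemma interior_segment X x y (s : R) :
  convex_set X -> X° x -> X y -> 0 < s <= 1 -> X° (y + s *: (x - y)).
Proof.
move=> cX ox Xy /andP[s0 s1].
pose back z := y + s^-1 *: (z - y).
have backx : back (y + s *: (x - y)) = x.
  by rewrite /back addrAC subrr add0r scalerA mulVf ?gt_eqF// scale1r addrC subrK.
have cback : back z @[z --> y + s *: (x - y)] --> back (y + s *: (x - y)).
  exact: (cvgD (cvg_cst y) (cvgZ (cvg_cst s^-1) (cvgB cvg_id (cvg_cst y)))).
have near_back : nbhs (y + s *: (x - y)) (back @^-1` X).
  by apply: cback; rewrite backx.
apply: filterS near_back => z Xz.
have -> : z = y + s *: (back z - y).
  by rewrite /back addrAC subrr add0r scalerA mulfV ?gt_eqF// scale1r addrC subrK.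
by apply: convex_set_segment => //; rewrite ltW.
Qed.

Lemma dotp_grad h y v : differentiable h y -> dotp (grad h y) v = 'D_v h y.
Proof.
move=> dh; rewrite deriveE// {2}[v]row_sum_delta linear_sum.
apply: eq_bigr => i _; rewrite linearZ/= mxE deriveE//.
by rewrite mulrC.
Qed.

Lemma directional_quotient h y v : differentiable h y ->
  s^-1 * (h (y + s *: v) - h y) @[s --> 0^'+] --> dotp (grad h y) v.
Proof.
move=> dh; apply: cvg_dnbhs_at_right; rewrite dotp_grad//.
under eq_fun do rewrite [y + _]addrC.
have : derivable h y v := diff_derivable (v := v) dh.
exact.
Qed.

(** The chord inequality divided by the parameter s, in the limit s -> 0+. *)
Lemma bregman_ge0 X h x y : convex_function X h -> X x -> X y ->
  differentiable h y -> 0 <= bregman h x y.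
Proof.
move=> ch Xx Xy dh; rewrite /bregman subr_ge0.
apply: cvgr_to_le (directional_quotient (v := x - y) dh) _.
near=> s.
have s0 : 0 < s by [].
have s1 : s <= 1 by near: s; exact: nbhs_right_le.
rewrite mulrC ler_pdivrMr// lerBlDl [_ * s]mulrC.
by apply: (convex_function_segment ch) => //; rewrite ltW.
Unshelve. all: by end_near. Qed.

Lemma interior_direction X w v : X° w -> exists2 e : R, 0 < e & X (w + e *: v).
Proof.
move=> ow.
have cw : w + s *: v @[s --> (0 : R)] --> w.
  rewrite -[X in _ --> X]addr0 -(scale0r v).
  exact: (cvgD (cvg_cst w) (cvgZ cvg_id (cvg_cst v))).
have [e [e0 Xe]] : exists e : R, 0 < e /\ X (w + e *: v).
  near (0 : R)^'+ => e; exists e; split=> //.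
  by near: e; exact: (cvg_at_right_filter cw ow).
by exists e.
Unshelve. all: by end_near. Qed.

(** Bounds from above along the directions +e_i and -e_i already control every
    coordinate, hence the maximum norm. *)
Lemma row_norm_bounded (p : nat -> 'rV[R]_d) :
  (forall v, exists B, forall k, dotp (p k) v <= B) ->
  exists B, forall k, `|p k| <= B.
Proof.
move=> /choice[B pB].
exists (\sum_i (`|B (delta_mx ord0 i)| + `|B (- delta_mx ord0 i)|)) => k.
rewrite -[leLHS]/(mx_norm (p k)) mx_normrE; apply/bigmax_leP; split=> [|[j i] _ /=].
  by apply: sumr_ge0 => i _; rewrite addr_ge0.
rewrite (bigD1 i)//= (ord1 j).
have h1 := pB (delta_mx ord0 i) k.
have h2 := pB (- delta_mx ord0 i) k.
rewrite -scaleN1r dotpZr !dotp_delta scaleN1r in h1 h2.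
rewrite ler_wpDr ?sumr_ge0//.
have := ler_norm (B (delta_mx ord0 i)); have := ler_norm (B (- delta_mx ord0 i)).
have := normr_ge0 (B (delta_mx ord0 i)); have := normr_ge0 (B (- delta_mx ord0 i)).
by move=> *; rewrite ler_norml; apply/andP; split; lra.
Qed.

(** Otherwise approach z along the segment from w. Minimality of z bounds the
    slopes <grad h (u_k), w - z> from below, and the gradient inequality at u_k,
    tested at the points w + e v of X around w, then bounds <grad h (u_k), v>
    from above for each direction v. So the gradients stay bounded, which
    essential smoothness forbids at a boundary point. *)
Lemma argmin_bregman_interior X S h y w z :
  legendre X h -> S `<=` X -> convex_set S -> X° y -> (S `&` X°) w ->
  argmin S (fun u => bregman h u y) z -> X° z.
Proof.
move=> [cX ch _ [_ dh blowup] _] SX cS oy [Sw ow] [Sz minz].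
have Xint := @interior_subset _ X.
apply: contrapT => noz.
(* harmonic k is 1 / (k + 1), so that u 0 = w *)
pose s (k : nat) : R := harmonic k; pose u k := z + s k *: (w - z).
have s01 k : 0 < s k <= 1 by rewrite invr_gt0 ltr0n/= invf_le1 ?ler1n ?ltr0n.
have ou k : X° (u k) by apply: interior_segment (SX _ Sz) _.
have Su k : S (u k).
  by apply: convex_set_segment => //; case/andP: (s01 k) => /ltW-> ->.
have uz : u @ \oo --> z.
  rewrite -[X in _ --> X]addr0 -(scale0r (w - z)).
  exact: (cvgD (cvg_cst z) (cvgZ cvg_harmonic (cvg_cst (w - z)))).
have [B gradB] : exists B, forall k, `|grad h (u k)| <= B.
  apply: row_norm_bounded => v.
  have [e e0 Xwv] := interior_direction v ow.
  pose c := dotp (grad h y) (w - z).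
  exists ((h (w + e *: v) - h y - dotp (grad h y) (z - y) + `|c| + `|c|) / e) => k.
  have /andP[sk0 sk1] := s01 k.
  (* g1, g2: gradient inequality at u k, tested at w + e v and at z; g3: lower
     bound on h (u k); g4: minimality of z against u k *)
  have g1 := bregman_ge0 ch Xwv (Xint _ (ou k)) (dh _ (ou k)).
  have g2 := bregman_ge0 ch (SX _ Sz) (Xint _ (ou k)) (dh _ (ou k)).
  have g3 := bregman_ge0 ch (Xint _ (ou k)) (Xint _ oy) (dh _ oy).
  have g4 := minz _ (Su k).
  rewrite /bregman in g1 g2 g3 g4.
  have e1 p : dotp p (w + e *: v - u k) = (1 - s k) * dotp p (w - z) + e * dotp p v.
    by rewrite -!dotpZr -dotpDr; congr dotp; apply/rowP => i; rewrite !mxE; ring.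
  have e2 p : dotp p (z - u k) = - s k * dotp p (w - z).
    by rewrite -dotpZr; congr dotp; apply/rowP => i; rewrite !mxE; ring.
  have e3 p : dotp p (u k - y) = dotp p (z - y) + s k * dotp p (w - z).
    by rewrite -dotpZr -dotpDr; congr dotp; rewrite /u addrAC.
  rewrite e1 e2 e3 -/c in g1 g2 g3 g4.
  set a := dotp _ (w - z) in g1 g2.
  have ca : c <= a by rewrite -(ler_pM2l sk0); lra.
  have cn : - `|c| <= c by rewrite lerNl -normrN ler_norm.
  have sc1 : - `|c| <= s k * c.
    by apply: le_trans (_ : s k * - `|c| <= _); rewrite ?ler_pM2l// mulrN lerN2 ler_piMl.
  have sc2 : - `|c| <= (1 - s k) * a.
    apply: le_trans (_ : (1 - s k) * - `|c| <= _).
      by rewrite mulrN lerN2 ler_piMl//; lra.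
    by rewrite ler_wpM2l//; lra.
  by rewrite ler_pdivlMr//; lra.
have bz : (closure X `\` X°) z by split => //; apply: subset_closure; exact: SX.
have /cvgryPgt/(_ B)/filter_ex[k] := blowup u z ou uz bz.
by rewrite ltNge gradB.
Qed.

(** First-order optimality: the derivative of u |-> D(u, y) at z in the feasible
    direction w - z is nonnegative. *)
Lemma argmin_bregman_variational S h y w z :
  convex_set S -> differentiable h z -> S w ->
  argmin S (fun u => bregman h u y) z ->
  dotp (grad h y) (w - z) <= dotp (grad h z) (w - z).
Proof.
move=> cS dh Sw [Sz minz].
apply: cvgr_to_ge (directional_quotient (v := w - z) dh) _.
near=> s.
have s0 : 0 < s by [].
have s1 : s <= 1 by near: s; exact: nbhs_right_le.
have := minz (z + s *: (w - z)) (convex_set_segment cS Sw Sz _).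
rewrite (ltW s0) => /(_ s1); rewrite /bregman [z + _ - y]addrAC.
rewrite [dotp _ (_ - _ + _)]dotpDr dotpZr.
by rewrite ler_pdivlMl//; lra.
Unshelve. all: by end_near. Qed.

Lemma bregman_three_points h x y z : bregman h x y =
  bregman h x z + bregman h z y + (dotp (grad h z) (x - z) - dotp (grad h y) (x - z)).
Proof. by rewrite /bregman !dotpBr; lra. Qed.

End Segments.

(** * Bregman projection on a hyperplane separating two points *)

Section HyperplaneProjection.
Context {R : realType} {d : nat}.
Implicit Types (X K C : set 'rV[R]_d) (f h : 'rV[R]_d -> R) (a x y z : 'rV[R]_d).
Implicit Types (g : 'rV[R]_d -> 'rV[R]_d) (delta G mu fs : R).

Lemma convex_setI X C : convex_set X -> convex_set C -> convex_set (X `&` C).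
Proof.
move=> cX cC x y s; rewrite !in_setI => /andP[xX xC] /andP[yX yC].
by apply/andP; split; [exact: cX|exact: cC].
Qed.

Lemma convex_set_hyperplane K a y delta :
  convex_set K -> convex_set (K `&` [set z | dotp a (y - z) = delta]).
Proof.
move=> cK; apply: convex_setI => // u v s /set_mem/= au /set_mem/= av.
apply/mem_set => /=; rewrite -segment_convE.
have -> : y - (v + s%:num *: (u - v)) = (y - v) + s%:num *: ((y - u) - (y - v)).
  by apply/rowP => i; rewrite !mxE; ring.
by rewrite dotpDr dotpZr dotpBr au av subrr mulr0 addr0.
Qed.

(** With L = <a, y - x>, the bound delta <= L says that the hyperplane separates
    y from x. It meets the segment [y, x] at w with
    L (w - z) = delta (x - z) + (L - delta) (y - z). In the variational
    inequality at w, the first term is evaluated by the three-point identity,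
    and the second one contributes the symmetrized divergence
    D(z, y) + D(y, z), of which only D(z, y) is kept. For L = delta this is the
    usual Pythagorean inequality; the gain grows with the distance of x beyond
    the hyperplane. *)
Lemma bregman_hyperplane_projection X K h a delta x y z :
  legendre X h -> K `<=` X -> convex_set K ->
  (K `&` X°) x -> (K `&` X°) y -> 0 < delta -> delta <= dotp a (y - x) ->
  argmin (K `&` [set u | dotp a (y - u) = delta]) (fun u => bregman h u y) z ->
  X° z /\ delta * bregman h x z + dotp a (y - x) * bregman h z y
            <= delta * bregman h x y.
Proof.
move=> legh KX cK [Kx ox] [Ky oy] delta0; set L := dotp a (y - x) => deltaL zmin.
have [cX ch _ [_ dh _] _] := legh.
set S := K `&` _ in zmin.
have L0 : 0 < L by lra.
have cS : convex_set S by exact: convex_set_hyperplane.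
pose w := y + (delta / L) *: (x - y).
have r01 : 0 < delta / L <= 1 by rewrite divr_gt0//= ler_pdivrMr// mul1r.
have Sw : S w.
  split.
    by apply: convex_set_segment => //; case/andP: r01 => /ltW->.
  have yw : y - w = (delta / L) *: (y - x) by apply/rowP => i; rewrite !mxE; ring.
  by rewrite /= yw dotpZr divfK// gt_eqF.
have ow : X° w by apply: interior_segment (KX _ Ky) _.
have SX : S `<=` X by move=> u [/KX].
have oz : X° z := argmin_bregman_interior legh SX cS oy (conj Sw ow) zmin.
split=> //.
have vi := argmin_bregman_variational cS (dh _ oz) Sw zmin.
have Dyz := bregman_ge0 ch (KX _ Ky) (interior_subset oz) (dh _ oz).
have wz p : L * dotp p (w - z) = delta * dotp p (x - z) + (L - delta) * dotp p (y - z).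
  rewrite -!dotpZr -dotpDr; congr dotp; apply/rowP => i; rewrite !mxE.
  by field; rewrite gt_eqF.
(* multiplied by L, the inequality becomes free of fractions *)
have {}vi : L * dotp (grad h y) (w - z) <= L * dotp (grad h z) (w - z).
  by rewrite ler_pM2l.
rewrite !wz in vi.
have yz : bregman h z y + bregman h y z =
    dotp (grad h y) (y - z) - dotp (grad h z) (y - z).
  by rewrite /bregman !dotpBr; lra.
have := bregman_three_points h x y z.
have : 0 <= (L - delta) * bregman h y z by rewrite mulr_ge0//; lra.
move: vi yz.
set b1 := bregman h x y; set b2 := bregman h x z; set b3 := bregman h z y.
set b4 := bregman h y z.
move=> vi /(congr1 (fun r => (L - delta) * r)) yz pos /(congr1 (fun r => delta * r)) tp.
by lra.
Qed.

(** Strong convexity gives <g y, y - x> >= delta + mu D(x, y), and the Lipschitz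
    condition gives D(z, y) >= delta^2 / (2 G^2), where delta = f y - fs; the
    projection inequality combines the two. *)
Lemma mirror_polyak_step X C f g h fs G mu x y z :
  legendre X h -> convex_set C -> 0 < G -> 0 < mu ->
  relatively_lipschitz X C g h G -> relatively_strongly_convex X C f g h mu ->
  (C `&` X°) x -> f x = fs -> (C `&` X°) y -> fs < f y ->
  argmin (polyak_feasible X C f g fs y) (fun u => bregman h u y) z ->
  (C `&` X°) z /\
  bregman h x z <= (1 - mu * (f y - fs) / (2 * G ^+ 2)) * bregman h x y.
Proof.
move=> legh cC G0 mu0 lip sc [Cx ox] fx [Cy oy] fsy zmin.
have [cX ch _ [_ dh _] _] := legh.
have Xint := @interior_subset _ X.
have feasE : polyak_feasible X C f g fs y =
    (X `&` C) `&` [set u | dotp (g y) (y - u) = f y - fs].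
  apply/seteqP; split=> u /=.
    by move=> [Xu Cu <-]; split=> //; rewrite !dotpBr; lra.
  by move=> [[Xu Cu]]; rewrite !dotpBr => e; split=> //; rewrite dotpBr; lra.
rewrite feasE in zmin.
have scx := sc y x (conj Cy oy) (conj Cx (Xint _ ox)).
have Dxy := bregman_ge0 ch (Xint _ ox) (Xint _ oy) (dh _ oy).
have gap : f y - fs + mu * bregman h x y <= dotp (g y) (y - x).
  by move: scx; rewrite fx !dotpBr; lra.
have muD : 0 <= mu * bregman h x y by rewrite mulr_ge0// ltW.
have Kx : ((X `&` C) `&` X°) x by split=> //; split=> //; exact: Xint.
have Ky : ((X `&` C) `&` X°) y by split=> //; split=> //; exact: Xint.
have delta0 : 0 < f y - fs by lra.
have drop : f y - fs <= dotp (g y) (y - x) by lra.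
have [oz proj] := bregman_hyperplane_projection legh (@subIsetl _ X C)
  (convex_setI cX cC) Kx Ky delta0 drop zmin.
have [[[Xz Cz] /= zE] _] := zmin.
have Dzy := bregman_ge0 ch Xz (Xint _ oy) (dh _ oy).
have := lip y z (conj Cy oy) (conj Cz Xz).
rewrite zE; set delta := f y - fs in delta0 zE gap drop proj *.
have D20 : 0 <= 2 * bregman h z y by lra.
move=> lipz.
have {}lipz : delta ^+ 2 <= G ^+ 2 * (2 * bregman h z y).
  rewrite -(sqr_sqrtr D20) -exprMn lerXn2r ?nnegrE ?mulr_ge0 ?sqrtr_ge0//; exact: ltW.
split=> //.
have G20 : 0 < 2 * G ^+ 2 by rewrite mulr_gt0// exprn_gt0.
have Dlow : delta ^+ 2 / (2 * G ^+ 2) <= bregman h z y.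
  by rewrite ler_pdivrMr//; lra.
rewrite -(ler_pM2l delta0).
have : mu * bregman h x y * (delta ^+ 2 / (2 * G ^+ 2)) <=
    dotp (g y) (y - x) * bregman h z y.
  apply: ler_pM => //; last by lra.
  by rewrite divr_ge0 ?sqr_ge0// ltW.
by move=> *; lra.
Qed.

(** The gap is at most <g y, y - x> - mu D(x, y) by strong convexity, and the
    linear term is bounded by the Lipschitz condition. *)
Lemma polyak_gap_le X C f g h fs G mu x y :
  relatively_lipschitz X C g h G -> relatively_strongly_convex X C f g h mu ->
  (C `&` X) x -> f x = fs -> (C `&` X°) y ->
  f y - fs + mu * bregman h x y <= G * Num.sqrt (2 * bregman h x y).
Proof.
move=> lip sc Cx fx Cy; apply: le_trans (lip _ _ Cy Cx).
by have := sc _ _ Cy Cx; rewrite fx !dotpBr; lra.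
Qed.

End HyperplaneProjection.

(** * The logarithmic rate *)

Section Rate.
Context {R : realType}.

Lemma ln_ge_half (T : nat) : (1 < T)%N -> 1 <= 2 * ln (T%:R : R).
Proof.
move=> T1; have T0 : 0 < T%:R :> R by rewrite ltr0n; apply: leq_trans T1.
have Tinv : T%:R^-1 <= 2^-1 :> R by rewrite lef_pV2 ?posrE// ler_nat.
have := @le_ln1Dx R (T%:R^-1 - 1).
rewrite ltrDr invr_gt0 T0 addrC subrK lnV ?posrE// => /(_ isT).
by lra.
Qed.

(** The contraction makes E decay like exp(- m t), whereas a t <= sqrt (E t)
    keeps E above m^2; at time T the two are compatible only for small m. *)
Lemma contraction_log_rate (E a : nat -> R) (m : R) (T : nat) : (1 < T)%N ->
  (forall t, (t <= T)%N -> [/\ m <= a t, 0 <= E t & a t + E t <= Num.sqrt (E t)]) ->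
  (forall t, (t < T)%N -> E t.+1 <= (1 - a t) * E t) ->
  m <= 2 * (ln T%:R / T%:R).
Proof.
move=> T1 bnd rec; rewrite leNgt; apply/negP => mbig.
have T0 : 0 < T%:R :> R by rewrite ltr0n; apply: leq_trans T1.
have lnT := ln_ge_half T1.
have rate0 : T%:R^-1 <= 2 * (ln (T%:R : R) / T%:R).
  by rewrite mulrA ler_peMl// invr_ge0 ltW.
have m0 : 0 < m by apply: lt_trans mbig; apply: lt_le_trans rate0; rewrite invr_gt0.
have sq t : (t <= T)%N -> 0 <= Num.sqrt (E t) /\ Num.sqrt (E t) ^+ 2 = E t.
  by move=> /bnd[_ E0 _]; rewrite sqrtr_ge0 sqr_sqrtr.
have E01 : E 0%N <= 1 /\ m <= 1.
  have [[ma E0 aE] [q0 qE]] := (bnd 0%N isT, sq 0%N isT).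
  set q := Num.sqrt (E 0%N) in aE q0 qE.
  have q1 : q <= 1.
    rewrite leNgt; apply/negP => q1.
    have : 0 <= q * (q - 1) by rewrite mulr_ge0//; lra.
    by rewrite mulrBr mulr1 -expr2 qE; lra.
  have : q * q <= 1 * q by rewrite ler_wpM2r.
  by rewrite -expr2 qE => ?; split; lra.
have Epow t : (t <= T)%N -> E t <= (1 - m) ^+ t.
  elim: t => [_|t IH tT]; first by rewrite expr0; case: E01.
  apply: le_trans (rec t tT) _.
  have [ma Et0 aE] := bnd t (ltnW tT).
  rewrite exprS; apply: le_trans (_ : (1 - m) * E t <= _).
    by rewrite ler_wpM2r//; lra.
  by rewrite ler_wpM2l ?IH ?(ltnW tT)//; case: E01; lra.
have ET : E T <= T%:R^-1 ^+ 2.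
  apply: le_trans (Epow T (leqnn T)) _.
  apply: le_trans (_ : expR (- m) ^+ T <= _).
    rewrite lerXn2r ?nnegrE ?expR_ge0//; first by case: E01; lra.
    exact: expR_ge1Dx.
  rewrite -[T%:R^-1]lnK ?posrE ?invr_gt0// lnV ?posrE// -!expRM_natl ler_expR.
  move: mbig; rewrite mulrA ltr_pdivrMr//.
  by lra.
have [mT ET0 aET] := bnd T (leqnn T).
have [q0 qE] := sq T (leqnn T).
have : Num.sqrt (E T) <= T%:R^-1.
  by rewrite -(ler_pXn2r (n:=2)) ?nnegrE ?invr_ge0 ?(ltW T0)// qE.
by lra.
Qed.

End Rate.

Theorem theorem9 (R : realType) (d : nat) (X C : set 'rV[R]_d)
    (f h : 'rV[R]_d -> R) (g : 'rV[R]_d -> 'rV[R]_d) (xstar : 'rV[R]_d)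
    (x : nat -> 'rV[R]_d) (G mu : R)
    (convX : convex_set X) (intX : X° !=set0)
    (convf : convex_function X f)
    (closedC : closed C) (convC : convex_set C)
    (xstar_min : argmin (X `&` C) f xstar)
    (g_subgrad : forall y, X° y -> subdifferential X f y (g y))
    (legh : legendre X h)
    (xstar_int : (rel_interior C `&` X°) xstar)
    (polyak_x : mirror_polyak X C f g h (f xstar) x)
    (G_gt0 : 0 < G) (mu_gt0 : 0 < mu)
    (lipf : relatively_lipschitz X C g h G)
    (scf : relatively_strongly_convex X C f g h mu)
    (T : nat) (T_gt1 : (1 < T)%N) :
  \big[Num.min/f (x 0%N)]_(0 <= t < T.+1) f (x t) - f xstar
    <= 4 * G ^+ 2 / mu * (ln T%:R / T%:R).
Proof.
set best := \big[_/_]_(_ <= _ < _) _.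
have best_le t : (t <= T)%N -> best <= f (x t).
  move=> tT; rewrite /best big_mkord.
  exact: (@bigmin_le _ _ _ _ (Ordinal (tT : (t < T.+1)%N)) (fun i : 'I_T.+1 => f (x i))).
have G2 : 0 < 2 * G ^+ 2 by rewrite mulr_gt0// exprn_gt0.
have [gap_le0|gap_gt0] := leP (best - f xstar) 0.
  apply: le_trans gap_le0 _; rewrite !mulr_ge0 ?invr_ge0 ?ler0n ?sqr_ge0 ?ltW//.
  by rewrite ln_gt0// ltr1n.
have [[_ Cxs] _] := xstar_min.
have oxs := xstar_int.2.
have [x0 xstep] := polyak_x.
have [_ ch _ [_ dh _] _] := legh.
have fgap t : (t <= T)%N -> f xstar < f (x t) by move=> /best_le; lra.
have step t : (t <= T)%N -> (C `&` X°) (x t) -> (C `&` X°) (x t.+1) /\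
    bregman h xstar (x t.+1)
      <= (1 - mu * (f (x t) - f xstar) / (2 * G ^+ 2)) * bregman h xstar (x t).
  move=> tT xt.
  exact: (mirror_polyak_step legh convC G_gt0 mu_gt0 lipf scf _ erefl xt (fgap t tT)).
have xin t : (t <= T)%N -> (C `&` X°) (x t).
  by elim: t => // t IH tT; have [] := step t (ltnW tT) (IH (ltnW tT)).
(* c^2 * 2 = mu^2 / (2 G^2) normalizes D_t; the square makes c come out of the
   square root in the Lipschitz bound *)
pose c := mu / (2 * G).
have c0 : 0 < c by rewrite divr_gt0// mulr_gt0.
have := @contraction_log_rate R (fun t => c ^+ 2 * (2 * bregman h xstar (x t)))
  (fun t => mu * (f (x t) - f xstar) / (2 * G ^+ 2))
  (mu * (best - f xstar) / (2 * G ^+ 2)) T T_gt1.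
have rescale : mu * (best - f xstar) / (2 * G ^+ 2) <= 2 * (ln T%:R / T%:R) ->
    best - f xstar <= 4 * G ^+ 2 / mu * (ln T%:R / T%:R).
  rewrite ler_pdivrMr// => H; rewrite -(ler_pM2l mu_gt0); apply: le_trans H _.
  by rewrite le_eqVlt; apply/orP; left; apply/eqP; field; rewrite ?gt_eqF// ?ltr0n// ltnW.
move=> rate; apply/rescale/rate => t tT; last first.
  rewrite [leRHS]mulrCA ler_pM2l ?exprn_gt0// [leRHS]mulrCA ler_pM2l//.
  exact: (step t (ltnW tT) (xin t (ltnW tT))).2.
have Dt := bregman_ge0 ch (interior_subset oxs)
  (interior_subset (xin t tT).2) (dh _ (xin t tT).2).
split.
- rewrite ler_pM2r ?invr_gt0// ler_pM2l// lerD2r; exact: best_le.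
- by rewrite mulr_ge0 ?sqr_ge0// mulr_ge0.
rewrite sqrtrM ?sqr_ge0// sqrtr_sqr gtr0_norm//.
have := polyak_gap_le lipf scf (conj Cxs (interior_subset oxs)) erefl (xin t tT).
have mG : 0 < mu / (2 * G ^+ 2) by rewrite divr_gt0.
rewrite -(ler_pM2l mG); congr (_ <= _); rewrite /c; field; rewrite gt_eqF//.
Qed.
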